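(* Assume $\cos\theta_\alpha-\cos\theta_\beta\cos\theta_\gamma\ge0$. Let $n=n_1n_2n_3$ and let $K_3\in\mathbb{C}^{n\times n}$ be the matrix $$K_3=\frac1{\delta_z}\begin{bmatrix}-I_{n_1n_2}&I_{n_1n_2}&&&\\&-I_{n_1n_2}&I_{n_1n_2}&&\\&&\ddots&\ddots&\\&&&-I_{n_1n_2}&I_{n_1n_2}\\ e^{\imath2\pi\mathbf{k}\cdot\mathbf{a}_3}J_3&&&&-I_{n_1n_2}\end{bmatrix},$$ with $J_3$ as defined in the context. The eigenpairs of $K_3$ can be written as $$\big(\delta_z^{-1}(e^{\theta_{i,j,k}}-1),\ \mathbf{z}_{i,j,k}\otimes\mathbf{y}_{i,j}\otimes\mathbf{x}_i\big),\qquad i=1,\dots,n_1,\ j=1,\dots,n_2,\ k=1,\dots,n_3$$ (that is, these numbers are the eigenvalues of $K_3$, counted with multiplicity, with the indicated corresponding eigenvectors), where $$\theta_{i,j,k}=\frac{\imath2\pi\left(k-\frac{m_3}{n_2}j-\frac{n_2-m_3}{n_2}\frac{m_1}{n_1}i+\frac{m_1-m_2}{n_1}i+\mathbf{k}\cdot\hat{\mathbf{a}}_3\right)}{n_3},\qquad\mathbf{z}_{i,j,k}=\begin{bmatrix}1&e^{\theta_{i,j,k}}&\cdots&e^{(n_3-1)\theta_{i,j,k}}\end{bmatrix}^\top,$$ with $$\hat{\mathbf{a}}_3=\mathbf{a}_3-\frac{m_3}{n_2}\mathbf{a}_2-\frac{n_2-m_3}{n_2}\frac{m_1}{n_1}\mathbf{a}_1+\frac{m_1-m_2}{n_1}\mathbf{a}_1+\rho_3\mathbf{a}_2-\frac{m_3}{n_2}\rho_1\mathbf{a}_1+\rho_2\mathbf{a}_1,$$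 and $\mathbf{x}_i=[1\ e^{\theta_i}\ \cdots\ e^{(n_1-1)\theta_i}]^\top$, $\theta_i=\frac{\imath2\pi(i+\mathbf{k}\cdot\mathbf{a}_1)}{n_1}$; $\mathbf{y}_{i,j}=[1\ e^{\theta_{i,j}}\ \cdots\ e^{(n_2-1)\theta_{i,j}}]^\top$, $\theta_{i,j}=\frac{\imath2\pi(j-\frac{m_1}{n_1}i+\mathbf{k}\cdot\hat{\mathbf{a}}_2)}{n_2}$, $\hat{\mathbf{a}}_2=\mathbf{a}_2-\frac{m_1}{n_1}\mathbf{a}_1+\rho_1\mathbf{a}_1$.
   Context: $\imath=\sqrt{-1}$ (distinct from the integer index $i$); $\mathbf{k}\in\mathbb{R}^3$ ($2\pi\mathbf{k}$ is the Bloch wave vector; distinct from the integer index $k$). The lattice translation vectors $\mathbf{a}_1,\mathbf{a}_2,\mathbf{a}_3\in\mathbb{R}^3$ are linearly independent and of the form $\mathbf{a}_1=(\|\mathbf{a}_1\|,0,0)^\top$, $\mathbf{a}_2=(\|\mathbf{a}_2\|\cos\theta_\gamma,\ \|\mathbf{a}_2\|\sin\theta_\gamma,\ 0)^\top$, $\mathbf{a}_3=(\|\mathbf{a}_3\|\cos\theta_\beta,\ \|\mathbf{a}_3\|\frac{\cos\theta_\alpha-\cos\theta_\gamma\cos\theta_\beta}{\sin\theta_\gamma},\ l_3)^\top$ with angles $\theta_\alpha,\theta_\beta,\theta_\gamma\in(0,\pi)$, $l_3=\|\mathbf{a}_3\|\frac{\sqrt{1-\cos^2\theta_\gamma-\cos^2\theta_\beta-\cos^2\theta_\alpha+2\cos\theta_\gamma\cos\theta_\beta\cos\theta_\alpha}}{\sin\theta_\gamma}>0$,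 and $\|\mathbf{a}_1\|\ge\|\mathbf{a}_2\|,\|\mathbf{a}_3\|$. Put $l_1=\|\mathbf{a}_1\|$, $l_2=\|\mathbf{a}_2\|\sin\theta_\gamma$; $n_1,n_2,n_3$ are positive integers and $\delta_x=l_1/n_1$, $\delta_y=l_2/n_2$, $\delta_z=l_3/n_3$. The lattice is adapted to the grid: there are integers $0\le m_1,m_2\le n_1$ and $0\le m_3\le n_2$ with - $m_1=\frac{\|\mathbf{a}_2\|\cos\theta_\gamma}{\delta_x}$ if $\cos\theta_\gamma\ge0$, and $m_1=\frac{\|\mathbf{a}_1\|+\|\mathbf{a}_2\|\cos\theta_\gamma}{\delta_x}$ if $\cos\theta_\gamma<0$; - $m_2=\frac{\|\mathbf{a}_3\|\cos\theta_\beta}{\delta_x}$ if $\cos\theta_\beta\ge0$, and $m_2=\frac{\|\mathbf{a}_1\|+\|\mathbf{a}_3\|\cos\theta_\beta}{\delta_x}$ if $\cos\theta_\beta<0$; - $m_3=\frac{\|\mathbf{a}_3\|}{\delta_y}\frac{\cos\theta_\alpha-\cos\theta_\gamma\cos\theta_\beta}{\sin\theta_\gamma}$ (in the case $\cos\theta_\alpha-\cos\theta_\gamma\cos\theta_\beta\ge0$ considered here). Constants: $\rho_1=\lceil\frac{2\theta_\gamma}{\pi}-1\rceil$, $\rho_2=\lceil\frac{2\theta_\beta}{\pi}-1\rceil$, $\rho_3=\lceil\cos\theta_\gamma\cos\theta_\beta-\cos\theta_\alpha\rceil$ (which equals $0$ here), $\rho_4=\lceil\cos\theta_\gamma\cos\theta_\beta(\cos\theta_\gamma\cos\theta_\beta-\cos\theta_\alpha)\rceil$;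 $\psi_1=1$ if $(\rho_2n_1-m_2)-(\rho_1n_1-m_1)>0$ and $\psi_1=0$ otherwise. Let $J_1=e^{\imath2\pi\rho_2\mathbf{k}\cdot\mathbf{a}_1}\begin{bmatrix}0&e^{-\imath2\pi\mathbf{k}\cdot\mathbf{a}_1}I_{m_2}\\ I_{n_1-m_2}&0\end{bmatrix}$, and for an integer $0\le m\le n_1$ let $S_m=\begin{bmatrix}0&e^{-\imath2\pi\mathbf{k}\cdot\mathbf{a}_1}I_{m}\\ I_{n_1-m}&0\end{bmatrix}\in\mathbb{C}^{n_1\times n_1}$. The matrix $J_3\in\mathbb{C}^{n_1n_2\times n_1n_2}$ is: (1) if $m_1\le m_2$: $J_3=e^{\imath2\pi\rho_3\mathbf{k}\cdot\mathbf{a}_2}\begin{bmatrix}0&e^{-\imath2\pi\mathbf{k}\cdot(\mathbf{a}_2+\rho_1\rho_4\mathbf{a}_1-\psi_1\mathbf{a}_1)}I_{m_3}\otimes S_{m_2-m_1}\\ I_{n_2-m_3}\otimes J_1&0\end{bmatrix}$; (2) if $m_1>m_2$: $J_3=e^{\imath2\pi\rho_3\mathbf{k}\cdot\mathbf{a}_2}\begin{bmatrix}0&e^{-\imath2\pi\mathbf{k}\cdot(\mathbf{a}_2-\rho_2\rho_4\mathbf{a}_1-\psi_1\mathbf{a}_1)}I_{m_3}\otimes S_{n_1-m_1+m_2}\\ I_{n_2-m_3}\otimes J_1&0\end{bmatrix}$. $\otimes$ is the Kronecker product, $I_m$ the identity of order $m$. Equivalently, on block vectors $v=(v_1,\dots,v_{n_3})$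 with $v_s\in\mathbb{C}^{n_1n_2}$, $(K_3v)_s=\delta_z^{-1}(v_{s+1}-v_s)$ with $v_{n_3+1}:=e^{\imath2\pi\mathbf{k}\cdot\mathbf{a}_3}J_3v_1$. *)

(* Defs.v *)
From HB Require Import structures.
From mathcomp Require Import all_boot all_order all_algebra.
From mathcomp Require Import complex mxtens.
From mathcomp Require Import reals sequences trigo exp.

Set Implicit Arguments.
Unset Strict Implicit.
Unset Printing Implicit Defensive.

Import Order.TTheory GRing.Theory Num.Theory.
Local Open Scope ring_scope.
Local Open Scope complex_scope.

Notation "A *t B" := (tensmx A B)
  (at level 40, left associativity, format "A  *t  B") : ring_scope.

(* The norm MathComp-Analysis puts on matrices is the sup norm, hence enorm. *)
Definition dot (R : realType) (u v : 'cV[R]_3) : R := \sum_i u i 0 * v i 0.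
Definition enorm (R : realType) (u : 'cV[R]_3) : R := Num.sqrt (dot u u).
Definition vec3 (R : realType) (x y z : R) : 'cV[R]_3 :=
  \col_i [:: x; y; z]`_i.

Definition cexp (R : realType) (z : R[i]) : R[i] :=
  (expR (complex.Re z) * cos (complex.Im z))
  +i* (expR (complex.Re z) * sin (complex.Im z)).
Definition itau (R : realType) : R[i] := 0 +i* (2 * pi).
(* e^{2 pi i t} *)
Definition phase (R : realType) (t : R) : R[i] := cexp (itau R * t%:C).

(* MathComp's eigenvalue and eigenspace concern row vectors, i.e. left
   eigenvectors. *)
Definition right_eigenpair (F : fieldType) n
    (A : 'M[F]_n) (lambda : F) (v : 'cV[F]_n) : Prop :=
  v != 0 /\ A *m v = lambda *: v.

(* The p x p block matrix whose (s, t) block is B s t. *)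
Definition blocks (T : Type) p q (B : 'I_p -> 'I_p -> 'M[T]_q) : 'M[T]_(p * q) :=
  \matrix_(r, c) B (mxtens_unindex r).1 (mxtens_unindex c).1
                   (mxtens_unindex r).2 (mxtens_unindex c).2.

Definition geomvec (R : realType) n (theta : R[i]) : 'cV[R[i]]_n :=
  \col_(s < n) cexp (s%:R * theta).

(* kvec is the Bloch wave vector divided by 2 pi. *)
Record crystal (R : realType) := Crystal {
  a1 : 'cV[R]_3; a2 : 'cV[R]_3; a3 : 'cV[R]_3;
  kvec : 'cV[R]_3;
  talpha : R; tbeta : R; tgamma : R;
  n1 : nat; n2 : nat; n3 : nat;
  m1 : nat; m2 : nat; m3 : nat }.

Section Crystal.
Context (R : realType) (X : crystal R).

Local Notation a1 := (a1 X).
Local Notation a2 := (a2 X).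
Local Notation a3 := (a3 X).
Local Notation kvec := (kvec X).
Local Notation talpha := (talpha X).
Local Notation tbeta := (tbeta X).
Local Notation tgamma := (tgamma X).
Local Notation n1 := (n1 X).
Local Notation n2 := (n2 X).
Local Notation n3 := (n3 X).
Local Notation m1 := (m1 X).
Local Notation m2 := (m2 X).
Local Notation m3 := (m3 X).
Local Notation C := R[i].

Definition l1 : R := enorm a1.
Definition l2 : R := enorm a2 * sin tgamma.
Definition l3 : R := enorm a3 *
  (Num.sqrt (1 - cos tgamma ^+ 2 - cos tbeta ^+ 2 - cos talpha ^+ 2
             + 2 * cos tgamma * cos tbeta * cos talpha) / sin tgamma).

Definition deltax : R := l1 / n1%:R.
Definition deltay : R := l2 / n2%:R.
Definition deltaz : R := l3 / n3%:R.

Definition lattice_form : Prop :=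
  [/\ free [:: a1; a2; a3],
      [/\ 0 < talpha < pi, 0 < tbeta < pi & 0 < tgamma < pi],
      [/\ a1 = vec3 (enorm a1) 0 0,
          a2 = vec3 (enorm a2 * cos tgamma) (enorm a2 * sin tgamma) 0
        & a3 = vec3 (enorm a3 * cos tbeta)
                    (enorm a3 * ((cos talpha - cos tgamma * cos tbeta) / sin tgamma)) l3],
      0 < l3
    & enorm a2 <= enorm a1 /\ enorm a3 <= enorm a1].

Definition grid_adapted : Prop :=
  [/\ [/\ (0 < n1)%N, (0 < n2)%N & (0 < n3)%N],
      [/\ (m1 <= n1)%N, (m2 <= n1)%N & (m3 <= n2)%N],
      m1%:R = (if 0 <= cos tgamma then enorm a2 * cos tgamma / deltax
               else (enorm a1 + enorm a2 * cos tgamma) / deltax),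
      m2%:R = (if 0 <= cos tbeta then enorm a3 * cos tbeta / deltax
               else (enorm a1 + enorm a3 * cos tbeta) / deltax)
    & m3%:R = enorm a3 / deltay * ((cos talpha - cos tgamma * cos tbeta) / sin tgamma)].

Definition rho1 : int := Num.ceil (2 * tgamma / pi - 1).
Definition rho2 : int := Num.ceil (2 * tbeta / pi - 1).
Definition rho3 : int := Num.ceil (cos tgamma * cos tbeta - cos talpha).
Definition rho4 : int :=
  Num.ceil (cos tgamma * cos tbeta * (cos tgamma * cos tbeta - cos talpha)).
Definition psi1 : int :=
  if 0 < (rho2 * n1%:Z - m2%:Z) - (rho1 * n1%:Z - m1%:Z) then 1 else 0.

(* In J1, Sshift and J3 the block sizes add up to the announced size only
   propositionally (using m <= n1 and m3 <= n2); conform_mx performs the cast. *)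
Definition J1 : 'M[C]_n1 :=
  phase (rho2%:~R * dot kvec a1) *:
  conform_mx 0
    (block_mx 0 (phase (- dot kvec a1) *: (1%:M : 'M_m2))
              (1%:M : 'M_(n1 - m2)) 0).

Definition Sshift (m : nat) : 'M[C]_n1 :=
  conform_mx 0
    (block_mx 0 (phase (- dot kvec a1) *: (1%:M : 'M_m))
              (1%:M : 'M_(n1 - m)) 0).

Definition J3 : 'M[C]_(n2 * n1) :=
  phase (rho3%:~R * dot kvec a2) *:
  conform_mx 0
    (block_mx 0
       (if (m1 <= m2)%N then
          phase (- dot kvec (a2 + (rho1 * rho4)%:~R *: a1 - psi1%:~R *: a1))
            *: ((1%:M : 'M_m3) *t Sshift (m2 - m1))
        else
          phase (- dot kvec (a2 - (rho2 * rho4)%:~R *: a1 - psi1%:~R *: a1))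
            *: ((1%:M : 'M_m3) *t Sshift (n1 - m1 + m2)))
       ((1%:M : 'M_(n2 - m3)) *t J1)
       0).

(* The contributions to a block are added, so that for n3 = 1 the only block
   is - 1 + e^{2 pi i k.a3} J3. *)
Definition K3 : 'M[C]_(n3 * (n2 * n1)) :=
  (deltaz^-1)%:C *:
  blocks (fun s t : 'I_n3 =>
    (if s == t then - (1%:M) else 0)
    + (if t == s.+1 :> nat then 1%:M else 0)
    + (if (s.+1 == n3) && (t == 0 :> nat) then phase (dot kvec a3) *: J3 else 0)).

Definition a2hat : 'cV[R]_3 := a2 - (m1%:R / n1%:R) *: a1 + rho1%:~R *: a1.

Definition a3hat : 'cV[R]_3 :=
  a3 - (m3%:R / n2%:R) *: a2
  - ((n2%:R - m3%:R) / n2%:R * (m1%:R / n1%:R)) *: a1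
  + ((m1%:R - m2%:R) / n1%:R) *: a1
  + rho3%:~R *: a2
  - (m3%:R / n2%:R * rho1%:~R) *: a1
  + rho2%:~R *: a1.

(* The indices i, j, l are the 1-based ones of the mathematical formulas; l is
   the third index, k denoting kvec. *)
Definition theta1 (i : nat) : C :=
  itau R * (i%:R + dot kvec a1)%:C / n1%:R.

Definition theta2 (i j : nat) : C :=
  itau R * (j%:R - m1%:R / n1%:R * i%:R + dot kvec a2hat)%:C / n2%:R.

Definition theta3 (i j l : nat) : C :=
  itau R
  * (l%:R - m3%:R / n2%:R * j%:R
     - (n2%:R - m3%:R) / n2%:R * (m1%:R / n1%:R) * i%:R
     + (m1%:R - m2%:R) / n1%:R * i%:R
     + dot kvec a3hat)%:C
  / n3%:R.

Definition eigval (i j l : nat) : C :=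
  (deltaz^-1)%:C * (cexp (theta3 i j l) - 1).

(* z (x) y (x) x; its type is a column since 1 * (1 * 1) computes to 1. *)
Definition eigvec (i j l : nat) : 'cV[C]_(n3 * (n2 * n1)) :=
  geomvec n3 (theta3 i j l)
    *t (geomvec n2 (theta2 i j) *t geomvec n1 (theta1 i)).

End Crystal.

(* Main.v *)
Require Import Defs.
From HB Require Import structures.
From mathcomp Require Import all_boot all_order all_algebra.
From mathcomp Require Import complex mxtens.
From mathcomp Require Import reals sequences trigo exp.
From mathcomp Require Import zify ring lra.

Set Implicit Arguments.
Unset Strict Implicit.
Unset Printing Implicit Defensive.

Import Order.TTheory GRing.Theory Num.Theory.
Local Open Scope ring_scope.
Local Open Scope complex_scope.

(** Write e(t) for [phase t], that is e^{2 pi i t}.  A geometric vector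
    w = (1, e(u), e(2u), ...) of length n is the restriction to 0 <= s < n of a
    function on all integers, with w (s + n) = e(nu) w s.  Hence a shift by m
    positions acts on w as multiplication by e(-mu), provided that the entries
    which wrap around are multiplied by the phase e(-nu).

    Each level of K3 is such a twisted shift.  On the x level the wrap phase
    is that of k.a1 up to the integer i ([shift_wave]).  On the y level the
    wrap block is itself a shift of the x level, by m2 - m1 modulo n1 in place
    of m2; the two agree on x_i exactly when the phase carried by the block
    absorbs the difference ([shift_tens_wave]).  This is an identity between
    multiples of k.a1, and it amounts to a relation between the integers rho1,
    rho2, rho4 and psi1 ([twist_cancels]), which follows from the signs of
    cos gamma and cos beta.  Thus y (x) x is an eigenvector of J3
    ([J3_wave]).  On the z level K3 is a cyclic difference operator whose wrap
    phase e(n3 u) fixes n3 theta_{i,j,k} modulo 2 pi i ([K3_eigvec]).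

    Completeness comes from discrete Fourier orthogonality: two geometric
    vectors whose frequencies differ by (j - i) / n with i <> j are orthogonal
    ([wave_orthogonal]).  The frequency on the z level depends on i and j, and
    that on the y level on i, but products of distinct modes still vanish: the
    first differing index in the order i, j, k kills its own factor.
    So the matrix of all eigenvectors is invertible, which gives both the basis
    and the factorization of the characteristic polynomial. *)

(** * Phases and geometric vectors *)

Lemma phaseE (R : realType) (t : R) :
  phase t = cos (2 * pi * t) +i* sin (2 * pi * t).
Proof.
rewrite /phase /cexp /itau /= !(mul0r, mulr0) !(subr0, add0r).
by rewrite expR0 !mul1r.
Qed.

Lemma phase0 (R : realType) : phase (0 : R) = 1.
Proof. by rewrite phaseE mulr0 cos0 sin0. Qed.

Lemma phaseD (R : realType) (s t : R) : phase (s + t) = phase s * phase t.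
Proof.
rewrite !phaseE mulrDr cosD sinD; apply/eqP; rewrite eq_complex /=.
by rewrite eqxx /= addrC.
Qed.

Lemma phaseNK (R : realType) (t : R) : phase (- t) * phase t = 1.
Proof. by rewrite -phaseD addNr phase0. Qed.

Lemma phase_nat (R : realType) (n : nat) : phase (n%:R : R) = 1.
Proof.
elim: n => [|n IHn]; first exact: phase0.
by rewrite -natr1 phaseD IHn mul1r phaseE mulr1 mulr_natl cos2pi sin2pi.
Qed.

Lemma phase_int (R : realType) (z : int) : phase (z%:~R : R) = 1.
Proof.
case: z => n; first exact: phase_nat.
rewrite NegzE mulrNz; have := phaseNK (n.+1%:R : R).
by rewrite phase_nat mulr1.
Qed.

Lemma phase_periodic (R : realType) (z : int) (s t : R) :
  s = t + z%:~R -> phase s = phase t.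
Proof. by move=> ->; rewrite phaseD phase_int mulr1. Qed.

Lemma phaseMn (R : realType) (n : nat) (t : R) :
  phase (n%:R * t) = phase t ^+ n.
Proof.
elim: n => [|n IHn]; first by rewrite mul0r phase0.
by rewrite -natr1 mulrDl mul1r phaseD IHn exprSr.
Qed.

Lemma phase_neq1 (R : realType) (t : R) : 0 < t < 1 -> phase t != 1.
Proof.
move=> /andP[t0 t1]; rewrite phaseE eq_complex /= negb_and.
have pi0 := pi_gt0 R.
have /sin_gt0_pi s0 : 0 < pi * t < pi by nra.
(* cos (2 pi t) = 1 - 2 sin^2 (pi t), and sin > 0 inside (0, pi). *)
have -> : 2 * pi * t = (pi * t) *+ 2 by ring.
rewrite cos_mulr2n cos2sin2; apply/orP; left.
by rewrite lt_eqF //; have := exprn_gt0 2 s0; lra.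
Qed.

Definition wave (R : realType) n (u : R) : 'cV[R[i]]_n :=
  \col_(s < n) phase (s%:R * u).

Lemma itau_div (R : realType) m (t : R) :
  itau R * t%:C / m%:R = itau R * (t / m%:R)%:C.
Proof. by rewrite rmorphM /= fmorphV /= rmorph_nat mulrA. Qed.

Lemma geomvec_wave (R : realType) n m (t : R) :
  geomvec n (itau R * t%:C / m%:R) = wave n (t / m%:R).
Proof.
apply/colP => s; rewrite !mxE /phase itau_div; congr cexp.
by rewrite [in RHS]rmorphM /= rmorph_nat mulrCA.
Qed.

(** The geometric sum of a non-trivial n-th root of unity vanishes.  Only the
    difference of the two frequencies matters, so the frequencies may carry an
    arbitrary common offset, as they do for a Bloch wave. *)
Lemma wave_orthogonal (R : realType) n (i j : 'I_n) (u v : R) :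
  v - u = (j%:R - i%:R) / n%:R ->
  (wave n (- u))^T *m wave n v = ((i == j)%:R * n%:R)%:M.
Proof.
move=> uv; have n0 : (0 < n)%N by case: n i {j uv} => [[]|].
have nR : 0 < n%:R :> R by rewrite ltr0n.
apply/matrixP => a b; rewrite !ord1 !mxE eqxx mulr1n.
have -> : \sum_s (wave n (- u))^T 0 s * wave n v s 0
   = \sum_(s < n) phase (v - u) ^+ s.
  apply: eq_bigr => s _; rewrite !mxE -phaseD -phaseMn; congr phase; ring.
case: eqP => [<-|/eqP ij] in uv *.
  rewrite uv subrr mul0r phase0 mul1r.
  by under eq_bigr do rewrite expr1n; rewrite sumr_const card_ord.
have : (phase (v - u) - 1) * \sum_(s < n) phase (v - u) ^+ s = 0.
  rewrite -subrX1 -phaseMn uv mulrC divfK ?gt_eqF //.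
  have := phase_int R (Posz j - Posz i); rewrite rmorphB /= => ->.
  by rewrite subrr.
rewrite mul0r; move/eqP; rewrite mulf_eq0 => /orP[|/eqP //].
rewrite subr_eq0 => /eqP uv1; exfalso.
have lt1 (k l : 'I_n) : (k < l)%N -> 0 < (l%:R - k%:R : R) / n%:R < 1.
  move=> kl; rewrite divr_gt0 ?subr_gt0 ?ltr_nat //= ltr_pdivrMr // mul1r.
  have := ltn_ord l; rewrite -(ltr_nat R) => ln; have := ler0n R k; lra.
have := ij; rewrite neq_ltn => /orP[] /lt1 /phase_neq1.
  by rewrite -uv uv1 eqxx.
suff -> : phase ((i%:R - j%:R) / n%:R : R) = 1 by rewrite eqxx.
have := phaseNK (v - u); rewrite uv1 mulr1 => <-; congr phase; rewrite uv; ring.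
Qed.

(** * Twisted shifts *)

(** Here and below [conform_mx 0] is a cast between sizes that are equal, but
    not convertible. *)
Lemma conform_mulmx (F : pzRingType) N N1 N2 (M : 'M[F]_(N1, N2))
    (w : 'cV[F]_N2) :
  N1 = N -> N2 = N ->
  conform_mx (0 : 'M_N) M *m conform_mx 0 w = conform_mx (0 : 'cV_N) (M *m w).
Proof. by move=> e1 e2; subst N1 N2; rewrite !conform_mx_id. Qed.

Lemma conform_scale (F : pzRingType) N N1 (c : F) (w : 'cV[F]_N1) :
  N1 = N -> conform_mx (0 : 'cV_N) (c *: w) = c *: conform_mx 0 w.
Proof. by move=> e; subst N1; rewrite !conform_mx_id. Qed.

(** An anti-diagonal block matrix swaps the two parts of a vector, whose sizes
    differ; hence v is read along both decompositions a + b and b + a. *)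
Lemma antidiag_block_eig (F : comNzRingType) N a b (U : 'M[F]_a) (L : 'M_b)
    (v : 'cV_N) (w1 w1' : 'cV_a) (w2 w2' : 'cV_b) (mu : F) :
  (a + b = N)%N ->
  v = conform_mx 0 (col_mx w1 w2) -> v = conform_mx 0 (col_mx w2' w1') ->
  U *m w1' = mu *: w1 -> L *m w2' = mu *: w2 ->
  conform_mx 0 (block_mx 0 U L 0) *m v = mu *: v.
Proof.
move=> abN v12 v21 Uw Lw.
rewrite {1}v21 conform_mulmx //; last by rewrite addnC.
rewrite mul_block_col !mul0mx add0r addr0 Uw Lw -scale_col_mx conform_scale //.
by rewrite -v12.
Qed.

Lemma wave_split (R : realType) n a b (u : R) : (a + b = n)%N ->
  wave n u = conform_mx 0 (col_mx (wave a u) (phase (a%:R * u) *: wave b u)).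
Proof.
move=> abn; subst n; rewrite conform_mx_id; apply/colP => s; rewrite mxE.
case: (split_ordP s) => t ->; rewrite ?col_mxEu ?col_mxEd !mxE //.
by rewrite -phaseD -mulrDl -natrD.
Qed.

Lemma conform_tens (F : pzRingType) n n' q (w : 'cV[F]_n') (x : 'cV_q) :
  n' = n ->
  (conform_mx (0 : 'cV_n) w *t x : 'cV_(n * q)) = conform_mx 0 (w *t x).
Proof. by move=> e; subst n'; rewrite !conform_mx_id. Qed.

Lemma tensZl (F : comPzRingType) m n p q (d : F)
    (A : 'M_(m, n)) (B : 'M_(p, q)) :
  (d *: A) *t B = d *: (A *t B).
Proof. by apply/matrixP => r s; rewrite !mxE mulrA. Qed.

Lemma tensZr (F : comPzRingType) m n p q (d : F)
    (A : 'M_(m, n)) (B : 'M_(p, q)) :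
  A *t (d *: B) = d *: (A *t B).
Proof. by apply/matrixP => r s; rewrite !mxE mulrCA. Qed.

Lemma tens_col_split (F : pzRingType) a b q (w1 : 'cV[F]_a) (w2 : 'cV_b)
    (x : 'cV_q) :
  (col_mx w1 w2 *t x : 'cV_((a + b) * q))
  = conform_mx 0 (col_mx (w1 *t x) (w2 *t x) : 'cV_(a * q + b * q)).
Proof.
have e := esym (mulnDl a b q).
rewrite -[col_mx (_ *t _) _](castmxK e (erefl _)) conform_castmx.
set c := castmx _ _; have -> : conform_mx (0 : 'cV_((a + b) * q)) c = c
  by exact: conform_mx_id.
rewrite {}/c; apply/colP => r; rewrite castmxE.
have q0 : (0 < q)%N by case: q r {x e} => // -[]; rewrite muln0.
rewrite -[r in LHS](cast_ordKV e) !mxE.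
case: (split_ordP (cast_ord (esym e) r)) => t ->; rewrite !mxE.
  case: (split_ordP (mxtens_unindex (cast_ord e (lshift (b * q) t))).1)
     => s es; rewrite !ord1.
    by congr (w1 _ _ * x _ _); apply/val_inj => //; exact: esym (congr1 val es).
  have := congr1 val es; rewrite /= => ets; exfalso.
  have := ltn_ord (mxtens_unindex t).1.
  by rewrite /= ets -ltn_subRL subnn.
case: (split_ordP (mxtens_unindex (cast_ord e (rshift (a * q) t))).1)
   => s es; rewrite !ord1.
  have := congr1 val es; rewrite /= divnMDl // => ets; exfalso.
  have := ltn_ord s.
  by rewrite -ets -ltn_subRL subnn.
have := congr1 val es; rewrite /= divnMDl // => /addnI ets.
by congr (w2 _ _ * x _ _); apply/val_inj; rewrite //= modnMDl.
Qed.

Lemma wave_tens_split (R : realType) n a b q (u : R) (x : 'cV[R[i]]_q) :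
  (a + b = n)%N ->
  (wave n u *t x : 'cV_(n * q)) =
  conform_mx 0 (col_mx (wave a u *t x : 'cV_(a * q))
                       (phase (a%:R * u) *: (wave b u *t x) : 'cV_(b * q))).
Proof.
move=> abn; subst n; rewrite (wave_split u (erefl (a + b)%N)) conform_mx_id.
rewrite tens_col_split; congr (conform_mx _ (col_mx _ _)).
exact: (tensZl _ (wave b u) x).
Qed.

Lemma shift_wave (R : realType) n m (u : R) (c : R[i]) :
  (m <= n)%N -> c = phase (- (n%:R * u)) ->
  conform_mx 0 (block_mx 0 (c *: (1%:M : 'M_m)) (1%:M : 'M_(n - m)) 0)
    *m wave n u = phase (- (m%:R * u)) *: wave n u.
Proof.
move=> mn ->; apply: antidiag_block_eig (wave_split u (subnKC mn))
  (wave_split u (subnK mn)) _ _; first exact: subnKC.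
  rewrite -scalemxAl mul1mx scalerA -phaseD; congr (phase _ *: _).
  by rewrite natrB //; ring.
by rewrite mul1mx scalerA phaseNK scale1r.
Qed.

(** The wrap block only has to act on x as B does, up to the phase gained by
    going once around, and only if there is a wrap block: when m = 0 the
    constants c and alpha are unconstrained. *)
Lemma shift_tens_wave (R : realType) n m q (A B : 'M[R[i]]_q) (x : 'cV_q)
    (u : R) (c alpha beta : R[i]) :
  (m <= n)%N -> A *m x = alpha *: x -> B *m x = beta *: x ->
  ((0 < m)%N -> c * alpha * phase (n%:R * u) = beta) ->
  conform_mx 0 (block_mx 0 (c *: ((1%:M : 'M_m) *t A))
                           ((1%:M : 'M_(n - m)) *t B) 0)
    *m (wave n u *t x : 'cV_(n * q))
  = (phase (- (m%:R * u)) * beta) *: (wave n u *t x).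
Proof.
move=> mn Ax Bx wrap.
have tensM p (w : 'cV[R[i]]_p) (D : 'M_q) :
    ((1%:M : 'M_p) *t D) *m (w *t x : 'cV_(p * q)) = w *t (D *m x).
  by have := tensmx_mul 1%:M D w x; rewrite mul1mx.
apply: antidiag_block_eig (wave_tens_split u x (subnKC mn))
  (wave_tens_split u x (subnK mn)) _ _; first by rewrite -mulnDl subnKC.
  case: m mn wrap => [|m] mn wrap; first by apply/colP => -[].
  rewrite -scalemxAl -scalemxAr tensM Ax tensZr !scalerA.
  congr (_ *: _); rewrite -(wrap isT) natrB //.
  rewrite [phase (- _) * _]mulrC -!mulrA -phaseD.
  have -> : n%:R * u - m.+1%:R * u = (n%:R - m.+1%:R) * u by ring.
  by rewrite [phase _ * _]mulrC.
rewrite tensM Bx tensZr scalerA; congr (_ *: _).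
by rewrite mulrAC phaseNK mul1r.
Qed.

(** When w is a common eigenvector of all the blocks, each block can be
    replaced by its eigenvalue, which leaves a p x p scalar problem. *)
Lemma blocks_tens (F : comPzRingType) p q (B : 'I_p -> 'I_p -> 'M[F]_q)
    (b : 'I_p -> 'I_p -> F) (z : 'cV_p) (w : 'cV_q) :
  (forall s t, B s t *m w = b s t *: w) ->
  blocks B *m (z *t w : 'cV_(p * q)) = ((\matrix_(s, t) b s t) *m z) *t w.
Proof.
move=> Bw; apply/colP => r.
rewrite !mxE mulr_suml.
have -> : \sum_j blocks B r j * (z *t w) j 0
  = \sum_(i : 'I_p) \sum_(j : 'I_q)
     B (mxtens_unindex r).1 i (mxtens_unindex r).2 j * (z i 0 * w j 0).
  rewrite pair_big /= (reindex (@mxtens_unindex p q)) /=; last first.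
    by exists (@mxtens_index p q) => k _;
       rewrite ?mxtens_unindexK ?mxtens_indexK.
  by apply: eq_bigr => k _; rewrite !mxE !ord1.
apply: eq_bigr => i _; rewrite !mxE !ord1.
have /colP/(_ (mxtens_unindex r).2) := Bw (mxtens_unindex r).1 i.
rewrite !mxE => e; rewrite mulrAC -e mulr_suml; apply: eq_bigr => j _; ring.
Qed.

Lemma cyclic_difference_wave (R : realType) n (u : R) :
  (\matrix_(s < n, t < n) ((if s == t then - 1 else 0)
     + (if t == s.+1 :> nat then 1 else 0)
     + (if (s.+1 == n) && (t == 0 :> nat) then phase (n%:R * u) else 0)))
   *m wave n u = (phase u - 1) *: wave n u.
Proof.
apply/colP => s; rewrite !mxE.
under eq_bigr do rewrite !mxE !mulrDl.
rewrite !big_split /= (bigD1 s) //= eqxx big1 ?addr0; last first.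
  by move=> t ts; rewrite eq_sym (negPf ts) mul0r.
rewrite mulN1r mulrBl mul1r [RHS]addrC -addrA; congr (_ + _).
have -> : phase u * phase (s%:R * u) = phase (s.+1%:R * u).
  by rewrite -phaseD -natr1; congr phase; ring.
have := ltn_ord s; rewrite leq_eqVlt => /orP[/eqP sn|sn].
  rewrite big1 ?add0r; last first.
    by move=> t _; rewrite sn ltn_eqF ?mul0r.
  have n0 : (0 < n)%N by rewrite -sn.
  rewrite (bigD1 (Ordinal n0)) //= sn eqxx /= big1 ?addr0.
    by rewrite mul0r phase0 mulr1.
  move=> t /eqP t0; case: eqP => [t0'|]; last by rewrite mul0r.
  by case: t0; apply/val_inj.
rewrite [X in _ + X]big1 ?addr0; last first.
  by move=> t _; rewrite ltn_eqF //= mul0r.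
rewrite (bigD1 (Ordinal sn)) //= eqxx mul1r big1 ?addr0 //.
move=> t /eqP ts; case: eqP => [ts'|]; last by rewrite mul0r.
by case: ts; apply/val_inj.
Qed.

(** * Diagonalization *)

Lemma char_poly_diagonalized (F : fieldType) n (A V : 'M[F]_n) (d : 'I_n -> F) :
  V \in unitmx -> (forall c, A *m col c V = d c *: col c V) ->
  char_poly A = \prod_c ('X - (d c)%:P).
Proof.
move=> Vu AV; have AVD : A *m V = V *m diag_mx (\row_c d c).
  apply/matrixP => r c; have /colP/(_ r) := AV c.
  rewrite mul_mx_diag !mxE mulrC => <-.
  by apply: eq_bigr => s _; rewrite !mxE.
(* Conjugating the characteristic matrix needs only V, lifted to polynomials:
   its determinant is a nonzero constant that cancels on both sides. *)
have cV : char_poly_mx A *m map_mx polyC V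
        = map_mx polyC V *m char_poly_mx (diag_mx (\row_c d c)).
  rewrite /char_poly_mx mulmxBl mulmxBr -!map_mxM AVD /=.
  by rewrite mul_scalar_mx mul_mx_scalar.
have := congr1 determinant cV; rewrite !det_mulmx mulrC => /mulfI.
rewrite det_map_mx polyC_eq0 -unitfE -unitmxE => /(_ Vu).
rewrite -!/(char_poly _) => ->; rewrite char_poly_trig ?diag_mx_is_trig //.
by apply: eq_bigr => c _; rewrite !mxE eqxx.
Qed.

Lemma basis_of_unitmx (F : fieldType) n (T : finType) (V : 'M[F]_n)
    (f : T -> 'cV[F]_n) (g : 'I_n -> T) :
  V \in unitmx -> (forall c, col c V = f (g c)) -> #|T| = n ->
  basis_of fullv [seq f p | p : T].
Proof.
move=> Vu Vf Tn.
rewrite basisEdim size_image Tn dimvf /dim /= muln1 leqnn andbT.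
apply/subvP => v _; rewrite -[v](mulKVmx Vu).
set w := invmx V *m v; have -> : V *m w = \sum_c w c 0 *: col c V.
  apply/colP => r; rewrite mxE summxE.
  by apply: eq_bigr => c _; rewrite !mxE mulrC.
apply: memv_suml => c _; apply/memvZ/memv_span; rewrite Vf.
exact: image_f.
Qed.

(** * Signs of the cosines and compatibility of the twists *)

(** This identifies rho1 and rho2 as indicators of obtuse angles. *)
Lemma ceil_obtuse (R : realType) (t : R) : 0 < t < pi ->
  Num.ceil (2 * t / pi - 1) = if cos t < 0 then 1 else 0.
Proof.
move=> /andP[t0 tpi]; have pi0 := pi_gt0 R.
have tE : 2 * t / pi * pi = 2 * t by rewrite divfK ?gt_eqF.
set s := 2 * t / pi in tE *.
have [cos_ge0|cos_lt0] := leP 0 (cos t); apply: ceil_def.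
  have tle : t <= pi / 2.
    rewrite leNgt; apply/negP => tgt.
    have : 0 < cos (pi - t) by apply: cos_gt0_pihalf; lra.
    by rewrite cosB cospi sinpi mul0r addr0 mulN1r oppr_gt0 ltNge cos_ge0.
  by rewrite /=; apply/andP; split; nra.
have tge : pi / 2 < t.
  rewrite ltNge; apply/negP => tle.
  suff : 0 <= cos t by rewrite leNgt cos_lt0.
  by apply: cos_ge0_pihalf; lra.
by rewrite /=; apply/andP; split; nra.
Qed.

Lemma cos_ltr_pi (R : realType) (t : R) : 0 < t < pi -> -1 < cos t < 1.
Proof.
move=> /sin_gt0_pi s0; have := cos2Dsin2 t => cs.
by apply/andP; split; nra.
Qed.

(** The ceiling takes only the values 0 and 1 because l3 > 0 makes the Gram
    determinant of the lattice directions positive, which bounds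
    cos alpha - cos gamma cos beta by sin gamma sin beta <= 1. *)
Lemma rho4E (R : realType) (X : crystal R) : lattice_form X ->
  0 < cos (talpha X) - cos (tgamma X) * cos (tbeta X) ->
  rho4 X = if cos (tgamma X) * cos (tbeta X) < 0 then 1 else 0.
Proof.
move=> [_ [_ _ hc] _ l30 _]; rewrite /rho4.
set g := cos (tgamma X); set b := cos (tbeta X) => d0.
have sg0 := sin_gt0_pi hc.
have L30 : 0 <= enorm (a3 X) by exact: sqrtr_ge0.
have q0 : 0 < 1 - g ^+ 2 - b ^+ 2 - cos (talpha X) ^+ 2
              + 2 * g * b * cos (talpha X).
  rewrite -sqrtr_gt0; move: l30; rewrite /l3 -/g -/b.
  rewrite mulrA pmulr_lgt0 ?invr_gt0 // => h.
  rewrite lt_neqAle sqrtr_ge0 andbT; apply/eqP => h0.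
  by move: h; rewrite -h0 mulr0 ltxx.
have [g1 gN1] := (cos_le1 (tgamma X), cos_geN1 (tgamma X)).
have [b1 bN1] := (cos_le1 (tbeta X), cos_geN1 (tbeta X)).
rewrite -/g -/b in g1 gN1 b1 bN1.
set d := cos (talpha X) - g * b in d0.
have gram : d ^+ 2 < (1 - g ^+ 2) * (1 - b ^+ 2).
  rewrite -subr_gt0; suff <- : 1 - g ^+ 2 - b ^+ 2 - cos (talpha X) ^+ 2
      + 2 * g * b * cos (talpha X) = (1 - g ^+ 2) * (1 - b ^+ 2) - d ^+ 2 by [].
  by rewrite /d; ring.
have d1 : d < 1.
  rewrite -(@expr_lt1 _ 2) ?ltW //; apply: lt_le_trans gram _.
  by rewrite mulr_ile1 //; nra.
have gb1 : -1 <= g * b <= 1 by apply/andP; split; nra.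
have -> : g * b * (g * b - cos (talpha X)) = - (g * b * d) by rewrite /d; ring.
move: gb1; generalize (g * b) => p /andP[pN1 p1].
by case: ltP => p0; apply: ceil_def => /=; apply/andP; split; nra.
Qed.

(** The relation that makes the wrap block of J3 agree with J1.  When m3 > 0,
    rho4 says whether cos gamma and cos beta have opposite strict signs.  A right
    angle forces the corresponding shift m1 or m2 to vanish.  An obtuse gamma
    gives m1 > 0, where |a2| <= |a1| is used, and an obtuse beta gives m2 < n1;
    these exclude the borderline combinations in which rho4 = 0 or psi1 = 0
    would break the identity. *)
Lemma twist_cancels (R : realType) (X : crystal R) :
  lattice_form X -> grid_adapted X ->
  0 <= cos (talpha X) - cos (tbeta X) * cos (tgamma X) -> (0 < m3 X)%N ->
  if (m1 X <= m2 X)%N then rho1 X * rho4 X = rho1 X - rho2 X + psi1 X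
  else rho2 X * rho4 X = 1 + rho2 X - rho1 X - psi1 X.
Proof.
move=> hX [[n10 n20 n30] [m1n m2n m3n] m1E m2E m3E] d0 m30.
have [_ [_ hb hc] _ l30 [L21 L31]] := hX.
have [/andP[gN1 g1] /andP[bN1 b1]] := (cos_ltr_pi hc, cos_ltr_pi hb).
have L2 : 0 <= enorm (a2 X) by exact: sqrtr_ge0.
have L3 : 0 < enorm (a3 X).
  rewrite lt_neqAle sqrtr_ge0 andbT; apply/eqP => h.
  by move: l30; rewrite /l3 -h mul0r ltxx.
have L1 : 0 < enorm (a1 X) by exact: lt_le_trans L31.
have dx : 0 < deltax X by rewrite /deltax /l1 divr_gt0 ?ltr0n.
have r1 := ceil_obtuse hc; have r2 := ceil_obtuse hb.
rewrite -/(rho1 X) in r1; rewrite -/(rho2 X) in r2.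
(* A zero value of cos alpha - cos gamma cos beta would give m3 = 0. *)
have r4 := rho4E hX _; rewrite {}r4; last first.
  rewrite lt_neqAle [_ * _ in X in _ && X]mulrC d0 andbT.
  apply/eqP => h; move: m3E; rewrite -h mul0r mulr0 => /eqP.
  by rewrite pnatr_eq0 -leqn0 leqNgt m30.
have m1pos : cos (tgamma X) < 0 -> (0 < m1 X)%N.
  move=> g0; rewrite -(ltr0n R) m1E leNgt g0 /= divr_gt0 //; nra.
have m2lt : cos (tbeta X) < 0 -> (m2 X < n1 X)%N.
  move=> b0; rewrite -(ltr_nat R) m2E leNgt b0 /= ltr_pdivrMr //.
  have -> : (n1 X)%:R * deltax X = enorm (a1 X).
    by rewrite mulrC /deltax divfK // pnatr_eq0 -lt0n.
  by nra.
have m1z : cos (tgamma X) == 0 -> m1 X = 0%N.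
  move=> /eqP g0; apply/eqP; rewrite -(pnatr_eq0 R) m1E g0 lexx.
  by rewrite mulr0 mul0r.
have m2z : cos (tbeta X) == 0 -> m2 X = 0%N.
  move=> /eqP b0; apply/eqP; rewrite -(pnatr_eq0 R) m2E b0 lexx.
  by rewrite mulr0 mul0r.
rewrite /psi1 r1 r2.
have r4 : (if cos (tgamma X) * cos (tbeta X) < 0 then 1 else 0 : int)
  = (if (0 < cos (tgamma X)) && (cos (tbeta X) < 0)
        || (cos (tgamma X) < 0) && (0 < cos (tbeta X)) then 1 else 0).
  case: (ltgtP (cos (tgamma X)) 0) => [g0|g0|->].
  - by rewrite (nmulr_rlt0 _ g0) orbC /= orbF.
  - by rewrite (pmulr_rlt0 _ g0) /= orbF.
  - by rewrite mul0r ltxx.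
rewrite {}r4; move: m1pos m2lt m1z m2z m1n m2n; clear -X.
move: (n1 X) (m1 X) (m2 X) => n p q.
case: (ltgtP (cos (tgamma X)) 0) => _;
  case: (ltgtP (cos (tbeta X)) 0) => _ /=; clear;
  case: ifP => pq; case: ifP => psi; lia.
Qed.

(** * Eigenvectors of the blocks *)

Lemma dotD (R : realType) (k u v : 'cV[R]_3) :
  dot k (u + v) = dot k u + dot k v.
Proof. by rewrite /dot -big_split; apply: eq_bigr => i _; rewrite mxE mulrDr. Qed.

Lemma dotZ (R : realType) (k u : 'cV[R]_3) c : dot k (c *: u) = c * dot k u.
Proof. by rewrite /dot mulr_sumr; apply: eq_bigr => i _; rewrite mxE mulrCA. Qed.

Lemma dotN (R : realType) (k u : 'cV[R]_3) : dot k (- u) = - dot k u.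
Proof. by rewrite -scaleN1r dotZ mulN1r. Qed.

(** The frequencies are real: each exponent theta is 2 pi i times one of
    them. *)
Definition freq1 (R : realType) (X : crystal R) (i : nat) : R :=
  (i%:R + dot (kvec X) (a1 X)) / (n1 X)%:R.
Definition freq2 (R : realType) (X : crystal R) (i j : nat) : R :=
  (j%:R - (m1 X)%:R / (n1 X)%:R * i%:R + dot (kvec X) (a2hat X)) / (n2 X)%:R.
Definition freq3 (R : realType) (X : crystal R) (i j l : nat) : R :=
  (l%:R - (m3 X)%:R / (n2 X)%:R * j%:R
   - ((n2 X)%:R - (m3 X)%:R) / (n2 X)%:R * ((m1 X)%:R / (n1 X)%:R) * i%:R
   + ((m1 X)%:R - (m2 X)%:R) / (n1 X)%:R * i%:R
   + dot (kvec X) (a3hat X)) / (n3 X)%:R.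

Lemma eigvec_wave (R : realType) (X : crystal R) i j l :
  eigvec X i j l = wave (n3 X) (freq3 X i j l)
    *t (wave (n2 X) (freq2 X i j) *t wave (n1 X) (freq1 X i)).
Proof. by rewrite /eigvec /theta3 /theta2 /theta1 !geomvec_wave. Qed.

Lemma eigval_phase (R : realType) (X : crystal R) i j l :
  eigval X i j l = ((deltaz X)^-1)%:C * (phase (freq3 X i j l) - 1).
Proof.
by rewrite /eigval /theta3 itau_div.
Qed.

Lemma Sshift_wave (R : realType) (X : crystal R) (i m : nat) :
  (0 < n1 X)%N -> (m <= n1 X)%N ->
  Sshift X m *m wave (n1 X) (freq1 X i)
  = phase (- (m%:R * freq1 X i)) *: wave (n1 X) (freq1 X i).
Proof.
move=> n10 mn; apply: shift_wave => //.
rewrite /freq1 [_ * (_ / _)]mulrC divfK ?pnatr_eq0 -?lt0n //.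
by apply: (@phase_periodic _ (Posz i)); rewrite /= -[(Posz i)%:~R]/(i%:R); ring.
Qed.

Lemma J1_wave (R : realType) (X : crystal R) (i : nat) :
  (0 < n1 X)%N -> (m2 X <= n1 X)%N ->
  J1 X *m wave (n1 X) (freq1 X i)
  = phase ((rho2 X)%:~R * dot (kvec X) (a1 X) - (m2 X)%:R * freq1 X i)
    *: wave (n1 X) (freq1 X i).
Proof.
move=> n10 mn; rewrite /J1 -scalemxAl -/(Sshift X (m2 X)) Sshift_wave //.
by rewrite scalerA -phaseD.
Qed.

(** Going once around the y direction multiplies y_{i,j} by
    e(k.a2 + rho1 k.a1 - m1 freq1), so the shift by m2 - m1 of the wrap block
    becomes the shift by m2 of J1; what remains is a multiple of k.a1 that
    vanishes by the relation between the rho and psi. *)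
Lemma J3_wave (R : realType) (X : crystal R) (i j : nat) :
  lattice_form X -> grid_adapted X ->
  0 <= cos (talpha X) - cos (tbeta X) * cos (tgamma X) ->
  J3 X *m (wave (n2 X) (freq2 X i j) *t wave (n1 X) (freq1 X i)
             : 'cV_(n2 X * n1 X))
  = phase ((rho3 X)%:~R * dot (kvec X) (a2 X)
           - (m3 X)%:R * freq2 X i j
           + ((rho2 X)%:~R * dot (kvec X) (a1 X) - (m2 X)%:R * freq1 X i))
    *: (wave (n2 X) (freq2 X i j) *t wave (n1 X) (freq1 X i)).
Proof.
move=> hX hg hcos; have twist := twist_cancels hX hg hcos.
have [[n10 n20 n30] [m1n m2n m3n] _ _ _] := hg.
have n1R : (n1 X)%:R != 0 :> R by rewrite pnatr_eq0 -lt0n.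
have n2R : (n2 X)%:R != 0 :> R by rewrite pnatr_eq0 -lt0n.
rewrite /J3 -scalemxAl.
set B := conform_mx _ _; set v := _ *t _.
suff : B *m v = (phase (- ((m3 X)%:R * freq2 X i j))
  * phase ((rho2 X)%:~R * dot (kvec X) (a1 X) - (m2 X)%:R * freq1 X i)) *: v.
  by move=> ->; rewrite scalerA !phaseD mulrA.
rewrite {}/B {}/v.
have [m12|m12] := leqP (m1 X) (m2 X);
  rewrite ?m12 ?(leqNgt (m1 X)) ?m12 /= in twist *.
  apply: shift_tens_wave => //.
  - by apply: Sshift_wave => //; lia.
  - exact: J1_wave.
  move=> /twist /(congr1 (fun z : int => z%:~R : R)).
  rewrite !rmorphD /= rmorphN => tw.
  rewrite -!phaseD; apply: (@phase_periodic _ (Posz j)).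
  rewrite -[(Posz j)%:~R]/(j%:R) !(dotD, dotN, dotZ) tw.
  rewrite /freq2 /freq1 /a2hat !(dotD, dotN, dotZ) natrB //.
  by field; rewrite n1R n2R.
apply: shift_tens_wave => //.
- by apply: Sshift_wave => //; lia.
- exact: J1_wave.
move=> /twist /(congr1 (fun z : int => z%:~R : R)).
rewrite !rmorphD /= !rmorphN rmorph1 => tw.
(* The shift n1 - m1 + m2 makes one more turn than m2 - m1; on x_i this turn
   costs the phase of k.a1 + i, hence the extra integer i. *)
rewrite -!phaseD; apply: (@phase_periodic _ (Posz j - Posz i)).
rewrite rmorphB /= -[(Posz j)%:~R]/(j%:R) -[(Posz i)%:~R]/(i%:R).
rewrite !(dotD, dotN, dotZ) tw.
rewrite /freq2 /freq1 /a2hat !(dotD, dotN, dotZ) natrB; last exact: m1n.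
by field; rewrite n1R n2R.
Qed.

Lemma K3_eigvec (R : realType) (X : crystal R) (i j l : nat) :
  lattice_form X -> grid_adapted X ->
  0 <= cos (talpha X) - cos (tbeta X) * cos (tgamma X) ->
  K3 X *m eigvec X i j l = eigval X i j l *: eigvec X i j l.
Proof.
move=> hX hg hcos; have J3w := J3_wave i j hX hg hcos.
have [[n10 n20 n30] [m1n m2n m3n] _ _ _] := hg.
have n1R : (n1 X)%:R != 0 :> R by rewrite pnatr_eq0 -lt0n.
have n2R : (n2 X)%:R != 0 :> R by rewrite pnatr_eq0 -lt0n.
have n3R : (n3 X)%:R != 0 :> R by rewrite pnatr_eq0 -lt0n.
rewrite eigval_phase eigvec_wave /K3 -scalemxAl -scalerA; congr (_ *: _).
set w : 'cV_(n2 X * n1 X) :=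
  wave (n2 X) (freq2 X i j) *t wave (n1 X) (freq1 X i).
(* freq3 solves n3 freq3 = k.a3 + (phase exponent of J3) + l. *)
have wrap : phase (dot (kvec X) (a3 X))
    *: J3 X *m w = phase ((n3 X)%:R * freq3 X i j l) *: w.
  rewrite -scalemxAl J3w scalerA -phaseD; congr (_ *: _).
  apply: (@phase_periodic _ (- Posz l)).
  rewrite rmorphN /= -[(Posz l)%:~R]/(l%:R).
  rewrite /freq3 /freq2 /freq1 /a2hat /a3hat !(dotD, dotN, dotZ).
  by field; rewrite n1R n2R n3R.
rewrite (@blocks_tens _ _ _ _ (fun s t : 'I_(n3 X) =>
     (if s == t then - 1 else 0)
     + (if t == s.+1 :> nat then 1 else 0)
     + (if (s.+1 == n3 X) && (t == 0 :> nat)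
        then phase ((n3 X)%:R * freq3 X i j l) else 0))); last first.
  move=> s t; rewrite !mulmxDl !scalerDl; congr (_ + _ + _).
  - by case: ifP; rewrite ?mulNmx ?mul1mx ?scaleN1r ?mul0mx ?scale0r.
  - by case: ifP; rewrite ?mul1mx ?scale1r ?mul0mx ?scale0r.
  - by case: ifP; rewrite ?wrap ?mul0mx ?scale0r.
by rewrite cyclic_difference_wave tensZl.
Qed.

(** * Completeness of the modes *)

Definition mode_index (R : realType) (X : crystal R)
    (c : 'I_(n3 X * (n2 X * n1 X))) : ('I_(n1 X) * 'I_(n2 X)) * 'I_(n3 X) :=
  let lji := mxtens_unindex c in
  let ji := mxtens_unindex lji.2 in ((ji.2, ji.1), lji.1).

Definition mode (R : realType) (X : crystal R)
    (p : ('I_(n1 X) * 'I_(n2 X)) * 'I_(n3 X)) : 'cV_(n3 X * (n2 X * n1 X)) :=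
  eigvec X p.1.1.+1 p.1.2.+1 p.2.+1.

Lemma mode_index_bij (R : realType) (X : crystal R) :
  bijective (@mode_index R X).
Proof.
exists (fun p => mxtens_index (p.2, mxtens_index (p.1.2, p.1.1))).
  by move=> c; apply/val_inj; rewrite /= -!divn_eq.
by case=> [[i j] l]; rewrite /mode_index !mxtens_indexK.
Qed.

(** All frequencies being real, this is the complex conjugate of [mode p]. *)
Definition dual_mode (R : realType) (X : crystal R)
    (p : ('I_(n1 X) * 'I_(n2 X)) * 'I_(n3 X)) : 'cV_(n3 X * (n2 X * n1 X)) :=
  wave (n3 X) (- freq3 X p.1.1.+1 p.1.2.+1 p.2.+1)
    *t (wave (n2 X) (- freq2 X p.1.1.+1 p.1.2.+1)
    *t wave (n1 X) (- freq1 X p.1.1.+1)).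

(** The x factors separate distinct i.  For equal i the y frequencies differ by
    (j' - j) / n2 exactly, and for equal i and j the z frequencies by
    (l' - l) / n3, so the next factor takes over. *)
Lemma dual_mode_orthogonal (R : realType) (X : crystal R)
    (p q : ('I_(n1 X) * 'I_(n2 X)) * 'I_(n3 X)) :
  ((dual_mode p)^T *m mode q) 0 0
  = (p == q)%:R * (n3 X * (n2 X * n1 X))%:R.
Proof.
case: p q => [[i j] l] [[i' j'] l']; rewrite /mode eigvec_wave /dual_mode /=.
have tensE n m (w w' : 'cV[R[i]]_n) (x x' : 'cV[R[i]]_m) :
    ((w *t x : 'cV_(n * m))^T *m (w' *t x' : 'cV_(n * m))) 0 0
    = (w^T *m w') 0 0 * (x^T *m x') 0 0.
  have /matrixP/(_ 0 0) := tensmx_mul w^T x^T w' x'.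
  by rewrite -trmx_tens => ->; rewrite mxE !ord1.
rewrite !tensE !xpair_eqE !natrM (@wave_orthogonal _ _ i i'); last first.
  by rewrite /freq1 -!natr1; ring.
have [ii'|_] := eqVneq i i'; last by rewrite !mxE !(mul0r, mulr0, mul0rn).
rewrite -ii' (@wave_orthogonal _ _ j j'); last by rewrite /freq2 -!natr1; ring.
have [jj'|_] := eqVneq j j'; last by rewrite !mxE !(mul0r, mulr0, mul0rn).
rewrite -jj' (@wave_orthogonal _ _ l l'); last by rewrite /freq3 -!natr1; ring.
by rewrite !mxE eqxx !mulr1n !mul1r /=; ring.
Qed.

Definition mode_mx (R : realType) (X : crystal R) :
    'M[R[i]]_(n3 X * (n2 X * n1 X)) :=
  \matrix_(r, c) mode (mode_index c) r 0.

Lemma col_mode_mx (R : realType) (X : crystal R) c :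
  col c (mode_mx X) = mode (mode_index c).
Proof. by apply/colP => r; rewrite !mxE. Qed.

Lemma mode_mx_unit (R : realType) (X : crystal R) :
  (0 < n3 X * (n2 X * n1 X))%N -> mode_mx X \in unitmx.
Proof.
set N := (_ * _)%N => N0.
have NR : N%:R != 0 :> R[i] by rewrite pnatr_eq0 -lt0n.
pose W : 'M_N := N%:R^-1 *: \matrix_(r, c) dual_mode (mode_index r) c 0.
suff /mulmx1_unit[] : W *m mode_mx X = 1%:M by [].
apply/matrixP => r c; rewrite -scalemxAl !mxE.
have := dual_mode_orthogonal (mode_index r) (mode_index c).
rewrite (inj_eq (bij_inj (mode_index_bij X))) mulrC -/N => E.
apply: (mulfI NR); rewrite mulrA mulfV // mul1r.
rewrite [RHS](_ : _ = N%:R * (r == c)%:R) -?E; last by case: (r == c).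
by rewrite mxE; apply: eq_bigr => s _; rewrite !mxE.
Qed.


Theorem theorem4p3 (R : realType) (X : crystal R)
    (hlattice : lattice_form X) (hgrid : grid_adapted X)
    (hcos : 0 <= cos (talpha X) - cos (tbeta X) * cos (tgamma X)) :
  [/\ forall (i : 'I_(n1 X)) (j : 'I_(n2 X)) (l : 'I_(n3 X)),
        right_eigenpair (K3 X) (eigval X i.+1 j.+1 l.+1)
                               (eigvec X i.+1 j.+1 l.+1),
      char_poly (K3 X) =
        \prod_(i < n1 X) \prod_(j < n2 X) \prod_(l < n3 X)
          ('X - (eigval X i.+1 j.+1 l.+1)%:P)
    & basis_of fullv
        [seq eigvec X p.1.1.+1 p.1.2.+1 p.2.+1
           | p : ('I_(n1 X) * 'I_(n2 X)) * 'I_(n3 X)]].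

Proof.
have [[n10 n20 n30] _ _ _ _] := hgrid.
have N0 : (0 < n3 X * (n2 X * n1 X))%N by rewrite !muln_gt0 n10 n20 n30.
have Vu := mode_mx_unit N0.
have modeK (p : ('I_(n1 X) * 'I_(n2 X)) * 'I_(n3 X)) :
    K3 X *m mode p = eigval X p.1.1.+1 p.1.2.+1 p.2.+1 *: mode p.
  exact: K3_eigvec.
have card_modes : #|{: ('I_(n1 X) * 'I_(n2 X)) * 'I_(n3 X)}|
    = (n3 X * (n2 X * n1 X))%N.
  by rewrite !card_prod !card_ord mulnC [(n1 X * _)%N]mulnC.
split.
- move=> i j l; split; last exact: modeK (i, j, l).
  have := dual_mode_orthogonal (X := X) (i, j, l) (i, j, l).
  rewrite eqxx mul1r /mode /= => h; apply/eqP => v0; move: h.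
  rewrite v0 mulmx0 mxE => /esym/eqP.
  by rewrite pnatr_eq0 -leqn0 leqNgt N0.
- rewrite (char_poly_diagonalized (d := fun c => let p := mode_index c in
     eigval X p.1.1.+1 p.1.2.+1 p.2.+1) Vu); last first.
    by move=> c; rewrite col_mode_mx modeK.
  rewrite pair_big pair_big /=.
  by rewrite [RHS](reindex _ (onW_bij _ (mode_index_bij X))).
- apply: (basis_of_unitmx (f := @mode R X) Vu _ card_modes) => c.
  exact: col_mode_mx.
Qed.
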